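(* Let $(\mathcal{H},d)$ be a Hadamard space, and let $C\subset\mathcal{H}$ and $C_n\subset\mathcal{H}$, $n\in\mathbb{N}$, be nonempty closed convex sets. If the sequence $(C_n)$ Mosco converges to $C$, then for every $x\in\mathcal{H}$: (i) $d(x,C_n)\to d(x,C)$ as $n\to\infty$; (ii) $P_{C_n}(x)\to P_C(x)$ as $n\to\infty$.
   Context: A Hadamard space is a complete geodesic metric space $(\mathcal{H},d)$ such that $d(x,\gamma(t))^2\le(1-t)d(x,\gamma(0))^2+t\,d(x,\gamma(1))^2-t(1-t)d(\gamma(0),\gamma(1))^2$ for every $x\in\mathcal{H}$, every (constant-speed) geodesic $\gamma:[0,1]\to\mathcal{H}$ and every $t\in[0,1]$. A set $C\subset\mathcal{H}$ is convex if $x,y\in C$ implies that the geodesic segment $[x,y]$ is contained in $C$. For a nonempty closed convex set $C$, $d(x,C)=\inf_{c\in C}d(x,c)$, and $P_C(x)$ is the metric projection, i.e. the unique point of $C$ with $d(x,P_C(x))=d(x,C)$. The indicator function $\iota_C$ of $C$ equals $0$ on $C$ and $\infty$ off $C$. Weak convergence: for a bounded sequence $(x_n)\subset\mathcal{H}$, the function $x\mapsto\limsup_{n\to\infty}d(x,x_n)^2$ has a unique minimizer on $\mathcal{H}$, called the asymptotic center of $(x_n)$. A bounded sequence $(x_n)$ weakly converges to $x\in\mathcal{H}$, written $x_n\stackrel{w}{\to}x$, if $x$ is the asymptotic center of each subsequence of $(x_n)$. Functions $f^n:\mathcal{H}\to(-\infty,\infty]$ converge to $f:\mathcal{H}\to(-\infty,\infty]$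 in the sense of Mosco if, for every $x\in\mathcal{H}$, (M1) $f(x)\le\liminf_{n\to\infty}f^n(x_n)$ whenever $x_n\stackrel{w}{\to}x$, and (M2) there exists a sequence $(y_n)\subset\mathcal{H}$ with $y_n\to x$ and $f^n(y_n)\to f(x)$. Closed convex sets $C_n$ Mosco converge to a closed convex set $C$ if $\iota_{C_n}\to\iota_C$ in the sense of Mosco. *)

(* Defs.v *)
From mathcomp Require Import all_boot all_order all_algebra.
From mathcomp Require Import all_classical all_reals all_analysis.

Set Implicit Arguments.
Unset Strict Implicit.
Unset Printing Implicit Defensive.

Import Order.TTheory GRing.Theory Num.Theory.
Import numFieldNormedType.Exports.

Local Open Scope classical_set_scope.
Local Open Scope ring_scope.

Section hadamard_spaces.
Context {R : realType} {H : metricType R}.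
Implicit Types (x y z : H) (C : set H) (u : nat -> H).

(* Constant-speed geodesics [0, 1] -> H are represented by functions on R of
   which only the values on [0, 1] matter. *)
Definition geodesic (g : R -> H) : Prop :=
  forall s t, 0 <= s <= 1 -> 0 <= t <= 1 ->
    mdist (g s) (g t) = `|s - t| * mdist (g 0) (g 1).

(* The union of all geodesics from x to y; in a Hadamard space there is only
   one such geodesic. *)
Definition geodesic_segment x y : set H :=
  [set z | exists g : R -> H, [/\ geodesic g, g 0 = x, g 1 = y &
    exists2 t, 0 <= t <= 1 & z = g t]].

Definition geodesically_convex C : Prop :=
  forall x y, C x -> C y -> geodesic_segment x y `<=` C.

Definition dist_set x C : R := inf [set mdist x c | c in C].

(* The default value x is taken only if x has no nearest point in C; in a
   Hadamard space each point has a unique nearest point in a nonempty closed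
   convex set. *)
Definition metric_projection C x : H :=
  xget x [set p | C p /\ mdist x p = dist_set x C].

Definition set_indicator C x : \bar R := if x \in C then 0%E else +oo%E.

Definition bounded_sequence u : Prop :=
  exists M : R, forall m n, mdist (u m) (u n) <= M.

Definition limsup_sqr_dist u x : \bar R :=
  limn_esup (fun n => (mdist x (u n) ^+ 2)%:E).

(* The minimizer is unique when u is bounded and H is a Hadamard space. *)
Definition is_asymptotic_center u x : Prop :=
  forall y, (limsup_sqr_dist u x <= limsup_sqr_dist u y)%E.

Definition weakly_converges u x : Prop :=
  bounded_sequence u /\
  forall phi : nat -> nat, increasing_seq phi ->
    is_asymptotic_center (u \o phi) x.

Definition mosco_converges (f_ : nat -> H -> \bar R) (f : H -> \bar R) : Prop :=
  forall x,
    (forall u, weakly_converges u x ->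
      (f x <= limn_einf (fun n => f_ n (u n)))%E) /\
    (exists y_ : nat -> H,
      y_ @ \oo --> x /\ (fun n => f_ n (y_ n)) @ \oo --> f x).

Definition set_mosco_converges (C_ : nat -> set H) C : Prop :=
  mosco_converges (fun n => set_indicator (C_ n)) (set_indicator C).

End hadamard_spaces.

Record hadamard_space (R : realType) (H : metricType R) : Prop := HadamardSpace {
  hadamard_complete : forall u : nat -> H, cauchy (u @ \oo) ->
    exists l : H, u @ \oo --> l ;
  hadamard_geodesic : forall x y : H, exists g : R -> H,
    [/\ geodesic g, g 0 = x & g 1 = y] ;
  hadamard_ineq : forall (x : H) (g : R -> H) (t : R),
    geodesic g -> 0 <= t <= 1 ->
    mdist x (g t) ^+ 2 <=
      (1 - t) * mdist x (g 0) ^+ 2 + t * mdist x (g 1) ^+ 2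
      - t * (1 - t) * mdist (g 0) (g 1) ^+ 2
}.

(* Main.v *)
Require Import Defs.
From mathcomp Require Import all_boot all_order all_algebra.
From mathcomp Require Import all_classical all_reals all_analysis.
From mathcomp Require Import lra.

(* Write p_n for the projection of x to C_n and p for its projection to C.  If
   d(x, p_n) stayed below l < d(x, C) along a subsequence, this bounded
   subsequence would have a further subsequence converging weakly to some q.
   Closed balls are weakly closed, so d(x, q) <= l, whereas (M1) puts q in C: a
   contradiction.  Conversely (M2) yields y_n in C_n with y_n -> p, which bounds
   d(x, C_n) from above and proves (i).  The midpoint of p_n and y_n lies in C_n,
   so the Hadamard inequality gives
     d(p_n, y_n)^2 <= 2 (d(x, y_n)^2 - d(x, C_n)^2) -> 0,
   hence (ii). *)

Set Implicit Arguments.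
Unset Strict Implicit.
Unset Printing Implicit Defensive.

Import Order.TTheory GRing.Theory Num.Theory.
Import numFieldNormedType.Exports.
Local Open Scope classical_set_scope.
Local Open Scope ring_scope.

(** * Real upper limits of bounded nonnegative sequences *)

Section real_limsup.
Context {R : realType}.
Implicit Types f : nat -> R.

(** Real-valued upper limit, taken as the infimum of eventual upper bounds. It agrees with
    [limn_esup] on bounded nonnegative sequences, so that all later estimates are real
    arithmetic. *)
Definition limsupr f : R := inf [set a | \forall n \near \oo, f n <= a].

Lemma limsupr_has_lbound f : (forall n, 0 <= f n) ->
  lbound [set a | \forall n \near \oo, f n <= a] 0.
Proof.
move=> f0 a /= [N _ fa]; apply: le_trans (f0 N) _.
exact: fa (leqnn N).
Qed.

Lemma limsupr_le f a : (forall n, 0 <= f n) ->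
  (\forall n \near \oo, f n <= a) -> limsupr f <= a.
Proof.
move=> f0 fa; apply: ge_inf => //; exists 0; exact: limsupr_has_lbound.
Qed.

Lemma limsupr_ge0 f M : (forall n, 0 <= f n <= M) -> 0 <= limsupr f.
Proof.
move=> fM; apply: lb_le_inf.
  by exists M; exists 0%N => // n _; case/andP: (fM n).
by apply: limsupr_has_lbound => n; case/andP: (fM n).
Qed.

Lemma limsupr_near f M e : (forall n, 0 <= f n <= M) -> 0 < e ->
  \forall n \near \oo, f n <= limsupr f + e.
Proof.
move=> fM e0.
have hi : has_inf [set a | \forall n \near \oo, f n <= a].
  split; first by exists M; exists 0%N => // n _; case/andP: (fM n).
  by exists 0; apply: limsupr_has_lbound => n; case/andP: (fM n).
have [a /= fa ae] := inf_adherent e0 hi.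
by apply: filterS fa => n /le_trans; apply; exact: ltW.
Qed.

Lemma limn_esup_limsupr f M : (forall n, 0 <= f n <= M) ->
  limn_esup (fun n => (f n)%:E) = (limsupr f)%:E.
Proof.
move=> fM; have f0 n : 0 <= f n by case/andP: (fM n).
apply/eqP; rewrite eq_le; apply/andP; split.
  apply/lee_addgt0Pr => e e0; rewrite -EFinD.
  have fe := limsupr_near fM e0.
  apply: (@le_trans _ _ (ereal_sup ((fun n => (f n)%:E) @`
      [set n | f n <= limsupr f + e]))).
    by apply: ereal_inf_lbound => /=; exists [set n | f n <= limsupr f + e].
  by apply: ge_ereal_sup => _ [n /= fn <-]; rewrite lee_fin.
apply: le_ereal_inf_tmp => /= _ [V [N _ NV] <-].
have ub n : V n -> ((f n)%:E <= ereal_sup ((fun n => (f n)%:E) @` V))%E.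
  by move=> Vn; apply: ereal_sup_ubound => /=; exists n.
move: (ereal_sup _) ub => [s| |] ub; first last.
- by have := ub N (NV N (leqnn N)).
- by rewrite leey.
rewrite lee_fin; apply: limsupr_le => //; exists N => // n /NV/ub.
by rewrite lee_fin.
Qed.

Lemma sqr_perturb (a e : R) : 0 <= a -> 0 < e -> exists2 d, 0 < d &
  forall s t, 0 <= s -> 0 <= t -> s ^+ 2 <= a -> t <= s + d -> t ^+ 2 <= a + e.
Proof.
(* Since [s ^+ 2 <= a] gives [s <= a + 1], and [d <= 1], the increase [2 * s * d + d ^+ 2] is at
   most [d * (2 * a + 3)], hence at most [e]. The summand [e] in the denominator ensures
   [d <= 1]. *)
move=> a0 e0; pose d := e / (2 * a + 3 + e).
have D0 : 0 < 2 * a + 3 + e by lra.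
have d0 : 0 < d by rewrite divr_gt0.
have dD : d * (2 * a + 3 + e) = e by rewrite /d mulfVK// lt0r_neq0.
have d1 : d <= 1 by rewrite ler_pdivrMr// mul1r; lra.
exists d => // s t s0 t0 sa tsd.
have s1 : s <= a + 1 by rewrite expr2 in sa; nra.
have : t ^+ 2 <= (s + d) ^+ 2 by rewrite lerXn2r// nnegrE; lra.
rewrite !expr2 in sa *; nra.
Qed.

End real_limsup.

(** * Subsequences of indices *)

Lemma increasing_seq_ge (phi : nat -> nat) : increasing_seq phi ->
  forall n, (n <= phi n)%N.
Proof.
move=> ip; elim=> // n IH; apply: leq_ltn_trans IH _.
by have := leW_mono ip n n.+1; rewrite ltEnat /= ltnS leqnn.
Qed.

Lemma increasing_seq_comp (phi psi : nat -> nat) : increasing_seq phi ->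
  increasing_seq psi -> increasing_seq (phi \o psi).
Proof. by move=> ip iq m n /=; rewrite ip; exact: iq. Qed.

Lemma not_near_subseq (P : nat -> Prop) : ~ (\forall n \near \oo, P n) ->
  exists2 phi : nat -> nat, increasing_seq phi & forall n, ~ P (phi n).
Proof.
move=> nP.
have H N : exists n, (N <= n)%N /\ ~ P n.
  apply: contrapT => /forallNP h; apply: nP; exists N => // n /= Nn.
  by apply: contrapT => nPn; apply: (h n).
have [g Hg] := choice H.
pose phi := fix phi n := if n is n'.+1 then g (phi n').+1 else g 0%N.
exists phi; last by case=> [|n] /=; [case: (Hg 0%N)|case: (Hg (phi n).+1)].
by apply/increasing_seqP => n /=; case: (Hg (phi n).+1).
Qed.

(** Any choice of preimages under [psi] inherits monotonicity, because [phi] and [psi] both preserve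
    and reflect the order. *)
Lemma increasing_seq_factor (phi psi : nat -> nat) : increasing_seq phi ->
  increasing_seq psi -> (forall n, exists m, phi n = psi m) ->
  exists2 tau, increasing_seq tau & phi =1 psi \o tau.
Proof.
move=> ip iq /choice[tau ht]; exists tau => // m n.
by rewrite -(ip m n) !ht; apply/esym/iq.
Qed.

(** * Asymptotic centers of bounded sequences *)

Section asymptotic_center.
Context {R : realType} {H : metricType R}.
Implicit Types (u v : nat -> H) (x y z : H) (D : set H).

Definition asymp_sqdist u y : R := limsupr (fun n => mdist y (u n) ^+ 2).

Lemma bounded_sequence_sqdist u y : bounded_sequence u ->
  exists M, forall n, 0 <= mdist y (u n) ^+ 2 <= M.
Proof.
move=> [M uM]; exists ((mdist y (u 0%N) + M) ^+ 2) => n.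
rewrite sqr_ge0 lerXn2r ?nnegrE ?mdist_ge0//.
  by rewrite addr_ge0 ?mdist_ge0// (le_trans _ (uM 0%N 0%N))// mdist_ge0.
by rewrite (le_trans (metric_triangle _ (u 0%N) _))// lerD2l.
Qed.

Lemma bounded_sequence_comp u (phi : nat -> nat) :
  bounded_sequence u -> bounded_sequence (u \o phi).
Proof. by move=> [M uM]; exists M => m n; exact: uM. Qed.

Lemma asymp_sqdist_le u y a : (\forall n \near \oo, mdist y (u n) ^+ 2 <= a) ->
  asymp_sqdist u y <= a.
Proof. by apply: limsupr_le => n; exact: sqr_ge0. Qed.

Lemma asymp_sqdist_ge0 u y : bounded_sequence u -> 0 <= asymp_sqdist u y.
Proof. by move=> /(bounded_sequence_sqdist y)[M /limsupr_ge0]. Qed.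

Lemma asymp_sqdist_near u y e : bounded_sequence u -> 0 < e ->
  \forall n \near \oo, mdist y (u n) ^+ 2 <= asymp_sqdist u y + e.
Proof. by move=> /(bounded_sequence_sqdist y)[M /limsupr_near uM] /uM. Qed.

Lemma limsup_sqr_distE u y : bounded_sequence u ->
  limsup_sqr_dist u y = (asymp_sqdist u y)%:E.
Proof. by move=> /(bounded_sequence_sqdist y)[M /limn_esup_limsupr]. Qed.

(** The indices [m] need not increase with [n], and finitely many terms of [v] are free; this suits
    diagonal sequences, which are subsequences of each stage only from some index on. *)
Lemma asymp_sqdist_subseq u v y : bounded_sequence u ->
  (\forall n \near \oo, exists2 m, (n <= m)%N & v n = u m) ->
  asymp_sqdist v y <= asymp_sqdist u y.
Proof.
move=> ub vu; apply/ler_addgt0Pr => e e0.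
have [N _ uN] := asymp_sqdist_near y ub e0.
apply: asymp_sqdist_le; near=> n.
have [m nm ->] : exists2 m, (n <= m)%N & v n = u m by near: n.
apply: uN => /=; apply: leq_trans nm; near: n; exact: nbhs_infty_ge.
Unshelve. all: by end_near. Qed.

Lemma asymp_sqdist_comp u y (phi : nat -> nat) : bounded_sequence u ->
  increasing_seq phi -> asymp_sqdist (u \o phi) y <= asymp_sqdist u y.
Proof.
move=> ub ip; apply: asymp_sqdist_subseq => //; near=> n.
by exists (phi n) => //; exact: increasing_seq_ge.
Unshelve. all: by end_near. Qed.

Lemma asymp_sqdist_cst x y : asymp_sqdist (fun=> x) y = mdist y x ^+ 2.
Proof.
apply/eqP; rewrite eq_le; apply/andP; split.
  by apply: asymp_sqdist_le; exists 0%N.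
apply/ler_addgt0Pr => e e0.
have ub : bounded_sequence (fun=> x) by exists (mdist x x).
by have [N _ /(_ N (leqnn N))] := asymp_sqdist_near y ub e0.
Qed.

Lemma weakly_convergesP u x : bounded_sequence u ->
  weakly_converges u x <-> forall phi : nat -> nat, increasing_seq phi ->
    forall y, asymp_sqdist (u \o phi) x <= asymp_sqdist (u \o phi) y.
Proof.
move=> ub; have E phi y := @limsup_sqr_distE (u \o phi) y
  (@bounded_sequence_comp u phi ub).
split=> [[_ h]|h]; last split=> //; move=> phi ip y; have := h phi ip y;
  by rewrite !E lee_fin.
Qed.

Context (hH : hadamard_space H).

Lemma hadamard_interpolation D y z (t : R) : geodesically_convex D ->
  D y -> D z -> 0 <= t <= 1 ->
  exists2 m, D m & forall x, mdist x m ^+ 2 <=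
    (1 - t) * mdist x y ^+ 2 + t * mdist x z ^+ 2
    - t * (1 - t) * mdist y z ^+ 2.
Proof.
move=> Dc Dy Dz t01.
have [g [gg g0 g1]] := hadamard_geodesic hH y z.
exists (g t); first by apply: (Dc y z) => //; exists g; split=> //; exists t.
by move=> x; rewrite -g0 -g1; exact: hadamard_ineq.
Qed.

(** The same point [m] serves every [u n], so the Hadamard inequality survives the upper limit. This
    strong convexity drives the existence of minimizers and the bound on weak limits. *)
Lemma asymp_sqdist_interpolation u D y z (t : R) : bounded_sequence u ->
  geodesically_convex D -> D y -> D z -> 0 <= t <= 1 ->
  exists2 m, D m & asymp_sqdist u m <=
    (1 - t) * asymp_sqdist u y + t * asymp_sqdist u z
    - t * (1 - t) * mdist y z ^+ 2.
Proof.
move=> ub Dc Dy Dz t01; have [m Dm hm] := hadamard_interpolation Dc Dy Dz t01.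
exists m => //; apply/ler_addgt0Pr => e e0; apply: asymp_sqdist_le.
have := asymp_sqdist_near z ub e0; have := asymp_sqdist_near y ub e0.
apply: filterS2 => n hy hz; have := hm (u n).
rewrite ![mdist (u n) _]metric_sym; case/andP: t01 => t0 t1.
set a := mdist m _ ^+ 2; set b := mdist y (u n) ^+ 2 in hy *.
set c := mdist z (u n) ^+ 2 in hz *; nra.
Qed.

(** Strong convexity makes a minimizing sequence Cauchy, and its limit is a minimizer. Taking [D] to
    be the whole space gives asymptotic centers; taking [u] constant gives nearest points. *)
Lemma asymp_center_exists u D : bounded_sequence u -> D !=set0 -> closed D ->
  geodesically_convex D ->
  exists2 q, D q & forall y, D y -> asymp_sqdist u q <= asymp_sqdist u y.
Proof.
move=> ub [d Dd] Dcl Dcv.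
pose E := asymp_sqdist u @` D; pose r := inf E.
have El : has_lbound E by exists 0 => _ [y _ <-]; exact: asymp_sqdist_ge0.
have Ei : has_inf E by split=> //; exists (asymp_sqdist u d), d.
have rE y : D y -> r <= asymp_sqdist u y by move=> Dy; apply: ge_inf => //; exists y.
have r0 : 0 <= r.
  by apply: lb_le_inf; [case: Ei|move=> _ [y _ <-]; exact: asymp_sqdist_ge0].
have near_inf (k : nat) : exists y, D y /\ asymp_sqdist u y < r + k.+1%:R^-1.
  have k0 : 0 < k.+1%:R^-1 :> R by rewrite invr_gt0.
  by have [_ [y Dy <-] ?] := inf_adherent k0 Ei; exists y.
have [y_ Hy] := choice near_inf.
have yD k : D (y_ k) by case: (Hy k).
have yr e : 0 < e -> \forall k \near \oo, asymp_sqdist u (y_ k) <= r + e.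
  move=> e0; near=> k; case: (Hy k) => _ /ltW/le_trans; apply.
  rewrite lerD2l invf_ple ?posrE// ltW//.
  apply: le_lt_trans (_ : k%:R < _); last by rewrite ltr_nat.
  near: k; exact: nbhs_infty_ger.
(* The midpoint has value at least [r], which bounds the distance of its endpoints. *)
have yC i j : mdist (y_ i) (y_ j) ^+ 2 <=
    2 * (asymp_sqdist u (y_ i) + asymp_sqdist u (y_ j)) - 4 * r.
  have h : 0 <= (2^-1 : R) <= 1 by apply/andP; split; lra.
  have [m Dm] := asymp_sqdist_interpolation ub Dcv (yD i) (yD j) h.
  have := rE m Dm; lra.
have [l yl] : exists l : H, y_ @ \oo --> l.
  apply: (hadamard_complete hH); apply: cauchy_exP => e e0.
  (* With both values at most [r + e ^+ 2 / 8], the bound [yC] becomes [e ^+ 2 / 2]. *)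
  have e2 : 0 < e ^+ 2 / 8 by rewrite divr_gt0// exprn_gt0.
  have [N _ hN] := yr _ e2.
  exists (y_ N); exists N => // k /= Nk; rewrite ballEmdist /=.
  rewrite -(@ltr_pXn2r _ 2)// ?nnegrE ?mdist_ge0 ?(ltW e0)//.
  have := yC N k; have /= := hN k Nk; have /= := hN N (leqnn N).
  have := exprn_gt0 2 e0; set b := e ^+ 2; lra.
have Dl : D l by apply: (closed_cvg _ Dcl _ _ yl); near=> k; exact: yD.
exists l => // y /rE; apply: le_trans; apply/ler_addgt0Pr => e e0.
(* Of the slack [e], one quarter pays for [y_ k] being only almost minimal, one quarter for the
   upper limit, and one half for replacing [y_ k] by [l] inside the square. *)
have e2 : 0 < e / 2 by rewrite divr_gt0.
have e4 : 0 < e / 4 by rewrite divr_gt0.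
have re : 0 <= r + e / 4 + e / 4 by lra.
have [dl dl0 hdl] := sqr_perturb re e2.
have [k [kl kr]] : exists k, mdist l (y_ k) < dl /\
    asymp_sqdist u (y_ k) <= r + e / 4.
  near \oo => k; exists k; split; near: k; last exact: yr.
  exact: (metricType_numDomainType.cvgr_dist_lt yl).
apply: asymp_sqdist_le; apply: filterS (asymp_sqdist_near (y_ k) ub e4) => n hn.
have -> : r + e = r + e / 4 + e / 4 + e / 2 by lra.
apply: (hdl (mdist (y_ k) (u n))); rewrite ?mdist_ge0//; first lra.
by rewrite addrC (le_trans (metric_triangle _ (y_ k) _))// lerD2r ltW.
Unshelve. all: by end_near. Qed.

(** * Existence of weakly convergent subsequences *)

Definition asymp_radius u : R := inf (range (asymp_sqdist u)).

Lemma asymp_radius_le u y : bounded_sequence u ->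
  asymp_radius u <= asymp_sqdist u y.
Proof.
move=> ub; apply: ge_inf; last by exists y.
by exists 0 => _ [z _ <-]; exact: asymp_sqdist_ge0.
Qed.

Lemma asymp_radius_subseq u v : bounded_sequence u -> bounded_sequence v ->
  (\forall n \near \oo, exists2 m, (n <= m)%N & v n = u m) ->
  asymp_radius v <= asymp_radius u.
Proof.
move=> ub vb vu; apply: lb_le_inf; first by exists (asymp_sqdist u (u 0%N)), (u 0%N).
move=> _ [y _ <-]; apply: le_trans (asymp_radius_le y vb) _.
exact: asymp_sqdist_subseq.
Qed.

Definition subseq_radius u : R :=
  inf [set asymp_radius (u \o phi) | phi in [set phi : nat -> nat | increasing_seq phi]].

Lemma subseq_radius_has_inf u : bounded_sequence u ->
  has_inf [set asymp_radius (u \o phi) | phi in [set phi : nat -> nat | increasing_seq phi]].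
Proof.
move=> ub; split; first by exists (asymp_radius (u \o id)), id.
exists 0 => _ [phi _ <-]; apply: lb_le_inf.
  by exists (asymp_sqdist (u \o phi) (u 0%N)), (u 0%N).
by move=> _ [y _ <-]; apply: asymp_sqdist_ge0; exact: bounded_sequence_comp.
Qed.

(* Diagonal argument: pass repeatedly to a subsequence that almost minimizes the
   asymptotic radius among all subsequences. *)
Lemma regular_subseq u : bounded_sequence u ->
  exists2 delta : nat -> nat, increasing_seq delta &
    forall phi : nat -> nat, increasing_seq phi ->
      asymp_radius (u \o delta) <= asymp_radius (u \o delta \o phi).
Proof.
move=> ub; have ubc phi := @bounded_sequence_comp u phi ub.
(* The pair holds the current index sequence and the stage number, so that a single choice function
   performs all stages, with tolerance [k.+1%:R^-1] at stage [k]. *)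
have step (a : (nat -> nat) * nat) : exists s : nat -> nat, increasing_seq s /\
    asymp_radius (u \o a.1 \o s) < subseq_radius (u \o a.1) + a.2.+1%:R^-1.
  have k0 : 0 < a.2.+1%:R^-1 :> R by rewrite invr_gt0.
  have [_ [s /= si <-] ?] := inf_adherent k0 (subseq_radius_has_inf (ubc a.1)).
  by exists s.
have [s Hs] := choice step.
pose psi := fix psi k : nat -> nat :=
  if k is k'.+1 then psi k' \o s (psi k', k') else id.
have si k : increasing_seq (s (psi k, k)) by case: (Hs (psi k, k)).
have psii k : increasing_seq (psi k).
  by elim: k => [|k IH] //=; exact: increasing_seq_comp.
have psi_tail k i m : exists2 m', (m <= m')%N & psi (k + i)%N m = psi k m'.
  elim: i m => [|i IH] m; first by exists m; rewrite ?addn0.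
  rewrite addnS /=; have [m' mm' ->] := IH (s (psi (k + i)%N, (k + i)%N) m).
  by exists m' => //; apply: leq_trans mm'; exact: increasing_seq_ge.
pose delta n := psi n n.
have delta_tail k n : (k <= n)%N -> exists2 m, (n <= m)%N & delta n = psi k m.
  by move=> kn; have := psi_tail k (n - k)%N n; rewrite subnKC.
have deltai : increasing_seq delta.
  apply/increasing_seqP => n; rewrite /delta /= (leW_mono (psii n)).
  exact: (increasing_seq_ge (si n)).
exists delta => // phi phii; apply/ler_addgt0Pr => e e0.
(* Up to the tolerance of stage [k], [subseq_radius (u \o psi k)] bounds the radius of [u \o delta]
   from above, and it bounds the radius of each of its subsequences from below. *)
have [k ke] : exists k : nat, k.+1%:R^-1 <= e.
  near \oo => k; exists k; rewrite invf_ple ?posrE// ltW//.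
  apply: le_lt_trans (_ : k%:R < _); last by rewrite ltr_nat.
  near: k; exact: nbhs_infty_ger.
have le1 : asymp_radius (u \o delta) <= asymp_radius (u \o psi k.+1).
  apply: asymp_radius_subseq => //; near=> n.
  have [|m nm dE] := @delta_tail k.+1 n; last by exists m; rewrite // /comp dE.
  by near: n; exact: nbhs_infty_ge.
have [_ /= /ltW le2] := Hs (psi k, k).
have le3 : subseq_radius (u \o psi k) <= asymp_radius (u \o delta \o phi).
  (* Shifting by [k] drops the initial terms, where [delta] may leave the range of [psi k]. *)
  have shi : increasing_seq (addn^~ k) by move=> m n; rewrite leEnat leq_add2r.
  have dpi := increasing_seq_comp (increasing_seq_comp deltai phii) shi.
  have [|tau taui tauE] := increasing_seq_factor dpi (psii k).
    move=> n /=; have [|m _ ->] := @delta_tail k (phi (n + k)%N); last by exists m.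
    by apply: leq_trans (increasing_seq_ge phii _); exact: leq_addl.
  apply: (@le_trans _ _ (asymp_radius (u \o psi k \o tau))).
    by apply: ge_inf; [case: (subseq_radius_has_inf (ubc (psi k)))|exists tau].
  apply: asymp_radius_subseq; [exact: (ubc (delta \o phi))|exact: (ubc (psi k \o tau))|].
  near=> n; exists (n + k)%N; first exact: leq_addr.
  by rewrite /= -[psi k (tau n)]tauE.
apply: le_trans le1 (le_trans le2 _); exact: lerD.
Unshelve. all: by end_near. Qed.

(** On a regular subsequence the center [q] stays a center of every further subsequence: passing to
    it can only lower the value at [q], which already equals a radius that cannot drop. *)
Lemma weakly_converging_subseq u : bounded_sequence u ->
  exists2 delta : nat -> nat, increasing_seq delta &
    exists q, weakly_converges (u \o delta) q.
Proof.
move=> ub; have [delta deltai hd] := regular_subseq ub.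
have db := @bounded_sequence_comp u delta ub.
have [||q _ hq] := @asymp_center_exists (u \o delta) setT db _ closedT.
- by exists (u 0%N).
- by move=> ? ? _ _.
exists delta => //; exists q; apply/weakly_convergesP => // phi phii y.
apply: le_trans (asymp_sqdist_comp q db phii) _.
apply: le_trans (asymp_radius_le y (@bounded_sequence_comp _ phi db)).
apply: le_trans (hd _ phii); apply: lb_le_inf.
  by exists (asymp_sqdist (u \o delta) q), q.
by move=> _ [z _ <-]; exact: hq.
Qed.

(** * Properties of weak limits *)

(** Closed balls are weakly closed: moving from [q] towards [x] by a fraction [t] cannot lower the
    asymptotic value, which yields [(1 - t) * mdist x q ^+ 2 <= l ^+ 2]; then [t] is made small. *)
Lemma weakly_converges_mdist_le u q x l : weakly_converges u q ->
  (forall n, mdist x (u n) <= l) -> mdist x q <= l.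
Proof.
move=> uq ul; have ub : bounded_sequence u by case: uq.
have l0 : 0 <= l := le_trans (mdist_ge0 x (u 0%N)) (ul 0%N).
rewrite -(@ler_pXn2r _ 2)// ?nnegrE ?mdist_ge0//.
have hq y : asymp_sqdist u q <= asymp_sqdist u y.
  by have /weakly_convergesP := uq => /(_ ub id); apply.
have xl : asymp_sqdist u x <= l ^+ 2.
  apply: asymp_sqdist_le; near=> n.
  by rewrite lerXn2r ?nnegrE ?mdist_ge0.
apply/ler_addgt0Pr => e e0.
have d0 := sqr_ge0 (mdist x q).
have D0 : 0 < mdist x q ^+ 2 + e by lra.
(* This choice gives [t * mdist x q ^+ 2 <= e], the error left by the factor [1 - t]. *)
pose t := e / (mdist x q ^+ 2 + e).
have t0 : 0 < t by rewrite divr_gt0.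
have t1 : t <= 1 by rewrite ler_pdivrMr// mul1r; lra.
have tD : t * (mdist x q ^+ 2 + e) = e by rewrite /t mulfVK// lt0r_neq0.
have [||m _ hm] := @asymp_sqdist_interpolation u setT q x t ub _ I I.
- by move=> ? ? _ _.
- by rewrite (ltW t0).
have := hq m; have := asymp_sqdist_ge0 q ub; rewrite (metric_sym q x) in hm.
set a := asymp_sqdist u q in hm *; set b := asymp_sqdist u x in hm xl *.
set d := mdist x q ^+ 2 in d0 tD hm *; move: (l ^+ 2) xl => L xl a0 am.
have : t * ((1 - t) * d) <= t * L by nra.
rewrite ler_pM2l// => ?; nra.
Unshelve. all: by end_near. Qed.

(* Mosco convergence tests full sequences only; a subsequence is completed by
   the constant value of its weak limit. *)
Lemma weakly_converges_fill u (theta : nat -> nat) q : increasing_seq theta ->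
  weakly_converges (u \o theta) q ->
  weakly_converges (fun n => if n \in range theta then u n else q) q.
Proof.
move=> thi uq; have utb : bounded_sequence (u \o theta) by case: uq.
set v := fun n => _.
have vb : bounded_sequence v.
  have [M hM] := utb; pose K := mdist q (u (theta 0%N)) + M.
  have K0 : 0 <= K.
    by rewrite addr_ge0 ?mdist_ge0// (le_trans _ (hM 0%N 0%N))// mdist_ge0.
  have vK n : mdist q (v n) <= K.
    rewrite /v; case: ifPn => [|_]; last by rewrite mdistxx.
    rewrite inE => -[k _ <-].
    by rewrite (le_trans (metric_triangle _ (u (theta 0%N)) _))// lerD2l; exact: hM.
  exists (K + K) => m n; rewrite (le_trans (metric_triangle _ q _))//.
  by rewrite lerD// metric_sym.
apply/weakly_convergesP => // chi chii y; apply/ler_addgt0Pr => e e0.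
have vchib := @bounded_sequence_comp v chi vb.
(* Terms violating the bound are at positive distance from [q], hence not fillers. They form a
   subsequence of [u \o theta], for which [q] is an asymptotic center: a contradiction. *)
apply: asymp_sqdist_le; apply: contrapT => /not_near_subseq[rho rhoi hrho].
have a0 := asymp_sqdist_ge0 y vchib.
have inth n : chi (rho n) \in range theta.
  apply/negPn/negP => nin; apply: (hrho n).
  by rewrite /= /v (negbTE nin) mdistxx expr0n /= addr_ge0// ltW.
have [|tau taui tauE] := increasing_seq_factor (increasing_seq_comp chii rhoi) thi.
  by move=> n; have := inth n; rewrite inE => -[k _ E]; exists k; rewrite /= E.
have vE : v \o chi \o rho = u \o theta \o tau.
  by apply/funext => n; rewrite /= /v inth; congr u; exact: tauE.
have /weakly_convergesP := uq => /(_ utb tau taui y); rewrite -vE => qy.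
have [N _ /(_ N (leqnn N))] :=
  asymp_sqdist_near q (@bounded_sequence_comp _ rho vchib) e0.
move=> /le_trans hN; apply: (hrho N); apply: hN.
by rewrite lerD2r (le_trans qy)// asymp_sqdist_comp.
Qed.

(** * Distance to a set and metric projection *)

Lemma dist_set_le D x y : D y -> dist_set x D <= mdist x y.
Proof.
move=> Dy; apply: ge_inf; last by exists y.
by exists 0 => _ [z _ <-]; exact: mdist_ge0.
Qed.

Lemma dist_set_ge0 D x : D !=set0 -> 0 <= dist_set x D.
Proof.
move=> [d Dd]; apply: lb_le_inf; first by exists (mdist x d), d.
by move=> _ [z _ <-]; exact: mdist_ge0.
Qed.

(** A nearest point to [x] is a minimizer over [D] for the constant sequence [x]. *)
Lemma metric_projectionP D x : D !=set0 -> closed D -> geodesically_convex D ->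
  D (metric_projection D x) /\ mdist x (metric_projection D x) = dist_set x D.
Proof.
move=> D0 Dcl Dcv.
have xb : bounded_sequence (fun=> x) by exists (mdist x x).
have [q Dq hq] := asymp_center_exists xb D0 Dcl Dcv.
suff : [set p | D p /\ mdist x p = dist_set x D] (metric_projection D x) by [].
apply: xgetPex; exists q; split => //; apply/eqP; rewrite eq_le dist_set_le// andbT.
apply: lb_le_inf; first by exists (mdist x q), q.
move=> _ [z /hq + <-]; rewrite !asymp_sqdist_cst !(metric_sym x).
by rewrite ler_pXn2r// nnegrE mdist_ge0.
Qed.

(** * Mosco convergence in terms of points *)

(** If [q] were outside [D], (M1) would force the lower limit of the indicators along the filled
    sequence to be [+oo], but they vanish at every index [theta N]. *)
Lemma mosco_subseq_limit (C_ : nat -> set H) D u (theta : nat -> nat) q :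
  set_mosco_converges C_ D -> increasing_seq theta ->
  (forall n, C_ (theta n) (u (theta n))) ->
  weakly_converges (u \o theta) q -> D q.
Proof.
move=> hM thi Cu uq; have [M1 _] := hM q.
have := M1 _ (weakly_converges_fill thi uq).
rewrite {1}/set_indicator; case: ifPn => [|_]; first by rewrite inE.
rewrite leye_eq => /eqP hoo; exfalso; move: hoo.
apply/eqP; rewrite lt_eqF//; apply: le_lt_trans (ltry 0).
(* The lower limit is minus the upper limit of the negated indicators, whose supremum over each tail
   is at least 0. *)
rewrite /limn_einf oppe_le0; apply: le_ereal_inf_tmp => _ [V [N _ NV] <-].
apply: ereal_sup_ubound; exists (theta N).
  by apply: NV => /=; exact: increasing_seq_ge.
rewrite /= /set_indicator; have -> : theta N \in range theta by rewrite inE; exists N.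
by rewrite mem_set ?oppe0.
Qed.

(** In (M2) the indicators tend to 0, so they are eventually finite, and a finite indicator means
    membership. *)
Lemma mosco_recovery_seq (C_ : nat -> set H) D p : set_mosco_converges C_ D -> D p ->
  exists2 y_ : nat -> H, y_ @ \oo --> p & \forall n \near \oo, C_ n (y_ n).
Proof.
move=> hM Dp; have [_ [y_ [yp yI]]] := hM p; exists y_ => //.
move: yI; rewrite {2}/set_indicator mem_set// => /fine_cvgP[+ _].
apply: filterS => n; rewrite /set_indicator; case: ifPn => //; by rewrite inE.
Qed.

Lemma mdist_cvg (y_ : nat -> H) p x : y_ @ \oo --> p ->
  (fun n => mdist x (y_ n)) @ \oo --> mdist x p.
Proof.
move=> yp; apply/cvgrPdist_lt => e e0.
apply: filterS (metricType_numDomainType.cvgr_dist_lt yp e0) => n hn.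
have := metric_triangle x p (y_ n); have := metric_triangle x (y_ n) p.
rewrite (metric_sym (y_ n) p) ltr_norml => ? ?; apply/andP; split; lra.
Qed.

(** * Convergence of distances and projections *)

Section mosco.
Context (C : set H) (C_ : nat -> set H).
Context (C0 : C !=set0) (Ccl : closed C) (Ccv : geodesically_convex C).
Context (C_0 : forall n, C_ n !=set0) (C_cl : forall n, closed (C_ n)).
Context (C_cv : forall n, geodesically_convex (C_ n)).
Context (hM : set_mosco_converges C_ C) (x : H).

Lemma mosco_dist_set_gt e : 0 < e ->
  \forall n \near \oo, dist_set x C - e < dist_set x (C_ n).
Proof.
move=> e0; apply: contrapT => /not_near_subseq[phi phii hphi].
pose p_ n := metric_projection (C_ n) x.
have Pp n : C_ n (p_ n) /\ mdist x (p_ n) = dist_set x (C_ n).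
  exact: metric_projectionP.
have pl n : mdist x (p_ (phi n)) <= dist_set x C - e.
  by rewrite (Pp _).2 leNgt; apply/negP; exact: hphi.
have pb : bounded_sequence (p_ \o phi).
  exists ((dist_set x C - e) + (dist_set x C - e)) => m n.
  apply: le_trans (metric_triangle _ x _) _.
  by apply: lerD; [rewrite metric_sym|]; exact: pl.
have [delta deltai [q hq]] := weakly_converging_subseq pb.
have Cq : C q.
  apply: (mosco_subseq_limit hM (increasing_seq_comp phii deltai) _ hq) => n.
  by case: (Pp (phi (delta n))).
have := dist_set_le x Cq.
have /= := @weakly_converges_mdist_le _ _ x _ hq (fun n => pl (delta n)).
lra.
Qed.

Lemma mosco_dist_set_cvg : (fun n => dist_set x (C_ n)) @ \oo --> dist_set x C.
Proof.
have [Cp pE] := metric_projectionP x C0 Ccl Ccv.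
have [y_ yp Cy] := mosco_recovery_seq hM Cp.
apply/cvgrPdist_lt => e e0; near=> n.
have lo : dist_set x C - e < dist_set x (C_ n) by near: n; exact: mosco_dist_set_gt.
have up : dist_set x (C_ n) <= mdist x (y_ n).
  by apply: dist_set_le; near: n.
have : `|mdist x (metric_projection C x) - mdist x (y_ n)| < e.
  by near: n; move/cvgrPdist_lt: (@mdist_cvg _ _ x yp); exact.
rewrite pE !ltr_norml => /andP[? ?]; apply/andP; split; lra.
Unshelve. all: by end_near. Qed.

Lemma mosco_metric_projection_cvg :
  (fun n => metric_projection (C_ n) x) @ \oo --> metric_projection C x.
Proof.
have [Cp pE] := metric_projectionP x C0 Ccl Ccv.
have [y_ yp Cy] := mosco_recovery_seq hM Cp.
(* Both squares tend to [dist_set x C ^+ 2], the second one by (i). *)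
have gap : (fun n => 2 * (mdist x (y_ n) ^+ 2 - dist_set x (C_ n) ^+ 2)) @ \oo --> (0 : R).
  have -> : 0 = 2 * (dist_set x C ^+ 2 - dist_set x C ^+ 2) :> R.
    by rewrite subrr mulr0.
  apply: cvgMr; apply: cvgB; under eq_fun do rewrite expr2; rewrite expr2.
    by rewrite -pE; apply: cvgM; exact: mdist_cvg.
  by apply: cvgM; exact: mosco_dist_set_cvg.
apply/metricType_numDomainType.cvgrPdist_lt => e e0; near=> n.
have [Cnp pnE] := metric_projectionP x (C_0 n) (@C_cl n) (@C_cv n).
have Cny : C_ n (y_ n) by near: n.
have h : 0 <= (2^-1 : R) <= 1 by apply/andP; split; lra.
(* The midpoint [m] is no closer to [x] than the projection, so its Hadamard inequality bounds the
   squared distance from the projection to [y_ n] by the quantity in [gap]. *)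
have [m Cm hm] := hadamard_interpolation (@C_cv n) Cnp Cny h.
have dm : dist_set x (C_ n) ^+ 2 <= mdist x m ^+ 2.
  by rewrite lerXn2r ?nnegrE ?mdist_ge0 ?dist_set_ge0// dist_set_le.
have gn : `|0 - 2 * (mdist x (y_ n) ^+ 2 - dist_set x (C_ n) ^+ 2)| < (e / 2) ^+ 2.
  near: n; move/cvgrPdist_lt: gap; apply.
  by rewrite exprn_gt0// divr_gt0.
have py : mdist (metric_projection (C_ n) x) (y_ n) < e / 2.
  rewrite -(@ltr_pXn2r _ 2)// ?nnegrE ?mdist_ge0 ?divr_ge0 ?(ltW e0)//.
  have := hm x; rewrite pnE; move: gn; rewrite ltr_norml => /andP[? ?] ?; lra.
have yn : mdist (metric_projection C x) (y_ n) < e / 2.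
  by near: n; apply: metricType_numDomainType.cvgr_dist_lt => //; rewrite divr_gt0.
rewrite (le_lt_trans (metric_triangle _ (y_ n) _))// (splitr e) ltrD//.
by rewrite metric_sym.
Unshelve. all: by end_near. Qed.

End mosco.

End asymptotic_center.

Theorem corollary4p2 (R : realType) (H : metricType R)
  (hH : hadamard_space H)
  (C : set H) (C_ : nat -> set H)
  (C0 : C !=set0) (Ccl : closed C) (Ccv : geodesically_convex C)
  (C_0 : forall n, C_ n !=set0) (C_cl : forall n, closed (C_ n))
  (C_cv : forall n, geodesically_convex (C_ n))
  (hM : set_mosco_converges C_ C) (x : H) :
  ((fun n => dist_set x (C_ n)) @ \oo --> dist_set x C) /\
  ((fun n => metric_projection (C_ n) x) @ \oo --> metric_projection C x).
Proof.
split; first exact: mosco_dist_set_cvg.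
exact: mosco_metric_projection_cvg.
Qed.
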